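(* Let $A$ be a positive definite Hermitian operator on $V$ with smallest and largest eigenvalues $\lambda_1<\lambda_N$, let $z\in\mathbb C$ with $\phi:=\arg z\in(-\pi,\pi)$, and let $w$ and $w_n$ be the exact solution and the $n$th conjugate gradient iterate for $(zI+A)w=g$. Then the error $e_n:=w_n-w$ satisfies $$|||e_n|||\le\sec(\tfrac12\phi)\,|T_n(s_z)|^{-1}\,|||e_0|||,\quad\text{where } s_z:=-\frac{\lambda_1+\lambda_N+2z}{\lambda_N-\lambda_1}.$$ With $\arg\sqrt{\lambda_j+z}\in(-\tfrac12\pi,\tfrac12\pi)$ for $j=1,N$, we may write $$T_n(s_z)=\tfrac12(\eta_z^n+\eta_z^{-n}),\quad\text{where }\eta_z:=-\frac{\sqrt{\lambda_N+z}-\sqrt{\lambda_1+z}}{\sqrt{\lambda_N+z}+\sqrt{\lambda_1+z}}.$$ Furthermore, $|\eta_z|\le1-c\lambda_N^{-1/2}$, where $c=c(z,\lambda_1)>0$ depends only on $z$ and $\lambda_1$ (not on $\lambda_N$).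
   Context: $V$ is a finite-dimensional complex inner product space with inner product $(\cdot,\cdot)$ and norm $\|\cdot\|$. Put $A_z:=zI+A$. Given $g,w_0\in V$, let $r_0:=g-A_zw_0$, $V_0:=\{0\}$ and $V_n:=\operatorname{span}\{r_0,A_zr_0,\dots,A_z^{n-1}r_0\}$ for $n\ge1$. The $n$th CG iterate is the unique $w_n=w_0+v_n$ with $v_n\in V_n$ such that $(A_zw_n,\varphi)=(g,\varphi)$ for all $\varphi\in V_n$. The norm is $|||v|||^2:=|z|\,\|v\|^2+(Av,v)$. $T_n$ is the Tchebyshev polynomial of degree $n$, defined by $T_n(\cos\theta)=\cos(n\theta)$ for $\theta\in\mathbb C$. *)

(* Defs.v *)
From mathcomp Require Import all_boot all_order all_algebra.
From mathcomp Require Import sesquilinear complex.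
From mathcomp Require Import all_classical all_reals all_analysis.
From mathcomp Require Import ring lra.

Set Implicit Arguments.
Unset Strict Implicit.
Unset Printing Implicit Defensive.

Import Order.TTheory GRing.Theory Num.Theory.

Local Open Scope ring_scope.
Local Open Scope complex_scope.

Import Normc.

Section ComplexFunctions.
Variable R : realType.
Implicit Types (z w theta : R[i]).

Definition expc z : R[i] :=
  (expR (complex.Re z))%:C * (cos (complex.Im z) +i* sin (complex.Im z)).

Definition cosc theta : R[i] :=
  (expc ('i%C * theta) + expc (- ('i%C * theta))) / 2.

(* Principal value in ]-pi, pi], see [argcP]; [argc 0 = 0]. *)
Definition argc z : R :=
  let t := acos (complex.Re z / normc z) in
  if z == 0 then 0 else if 0 <= complex.Im z then t else - t.

Lemma argcP z : z = (normc z)%:C * expc ('i%C * (argc z)%:C) /\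
  - pi < argc z <= pi.
Proof.
have e0 (t : R) : expc ('i%C * t%:C) = cos t +i* sin t.
  rewrite /expc /real_complex_def /=; simpc.
  by rewrite expR0 !mul1r.
rewrite e0 /argc; case: eqP => [->|/eqP z0].
  by rewrite normc0 mul0r; split=> //; rewrite oppr_lt0 pi_gt0 pi_ge0.
have [] : 0 < normc z /\ normc z ^+ 2 = complex.Re z ^+ 2 + complex.Im z ^+ 2.
  case: z z0 => a b z0 /=; rewrite sqr_sqrtr ?addr_ge0 ?sqr_ge0//; split=> //.
  rewrite sqrtr_gt0 lt_def addr_ge0 ?sqr_ge0// andbT paddr_eq0 ?sqr_ge0//.
  by rewrite !sqrf_eq0; apply: contra z0 => /andP[/eqP-> /eqP->].
move: (normc z) => r r0 r2.
case: z z0 r2 => a b /= z0 r2.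
have ar : (a / r) ^+ 2 = 1 - (b / r) ^+ 2.
  by apply: (@mulIf _ (r ^+ 2)); [by rewrite expf_neq0 ?gt_eqF|];
     rewrite mulrBl mul1r -!exprMn !divfK ?gt_eqF// r2 addrK.
have art : -1 <= a / r <= 1.
  by rewrite -ler_norml -(@ler_pXn2r _ 2)// ?nnegrE// expr1n real_normK ?num_real// ar
    gerBl sqr_ge0.
have sn : sin (acos (a / r)) = `|b| / r.
  rewrite sin_acos// ar subKr sqrtr_sqr normrM; congr (_ * _).
  by rewrite gtr0_norm// invr_gt0.
have csn : cos (acos (a / r)) = a / r by rewrite acosK.
have tp : acos (a / r) <= pi by exact: acos_lepi.
have t0 : 0 <= acos (a / r) by exact: acos_ge0.
have rr x : r * (x / r) = x by rewrite mulrC divfK// gt_eqF.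
case: (leP 0 b) => b0; rewrite ?cosN ?sinN csn sn; split.
- by rewrite /real_complex_def; simpc; rewrite ger0_norm// !rr.
- by rewrite tp (lt_le_trans _ t0)// oppr_lt0 pi_gt0.
- by rewrite /real_complex_def; simpc; rewrite ltr0_norm// !rr opprK.
- rewrite ltrN2 (le_trans _ (pi_ge0 R)) ?oppr_le0// andbT acos_ltpi//.
  case/andP: art => art ->; rewrite andbT lt_neqAle art andbT.
  apply/negP => /eqP ea; move: ar; rewrite -ea sqrrN expr1n => ar.
  have /eqP : (b / r) ^+ 2 = 0 by lra.
  by rewrite sqrf_eq0 mulf_eq0 invr_eq0 (gt_eqF r0) (lt_eqF b0).
Qed.

Definition is_chebyshev (n : nat) (T : {poly R[i]}) : Prop :=
  size T = n.+1 /\ forall theta, T.[cosc theta] = cosc (n%:R * theta).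

Lemma expcD z w : expc (z + w) = expc z * expc w.
Proof.
case: z w => [a b] [c d]; rewrite /expc /real_complex_def /=; simpc.
by rewrite expRD cosD sinD; congr (_ +i* _); ring.
Qed.

Lemma expc0 : expc 0 = 1.
Proof. by rewrite /expc /real_complex_def /= expR0 cos0 sin0; simpc. Qed.

Lemma expcMn n z : expc (n%:R * z) = expc z ^+ n.
Proof.
elim: n => [|n IH]; first by rewrite mul0r expc0 expr0.
by rewrite -natr1 mulrDl mul1r expcD IH exprSr.
Qed.

Lemma coscMn n theta : cosc (n%:R * theta) =
  (expc ('i%C * theta) ^+ n + expc (- ('i%C * theta)) ^+ n) / 2.
Proof. by rewrite /cosc mulrCA -mulrN !expcMn. Qed.

Fixpoint chebyshev (n : nat) : {poly R[i]} :=
  match n with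
  | 0 => 1
  | 1 => 'X
  | (m.+1 as k).+1 => 2%:P * 'X * chebyshev k - chebyshev m
  end.

Lemma chebyshevP n : is_chebyshev n (chebyshev n).
Proof.
suff : is_chebyshev n (chebyshev n) /\ is_chebyshev n.+1 (chebyshev n.+1).
  by case.
elim: n => [|n [[sn en] [sn1 en1]]].
  split; split=> [|theta]; rewrite ?size_poly1 ?size_polyX//.
    by rewrite hornerC coscMn !expr0 -[_ + _]/(2%:R) divff ?pnatr_eq0.
  by rewrite hornerX mul1r.
split=> //; split => [|theta].
  have s : size (2%:P * 'X * chebyshev n.+1) = n.+3.
    rewrite -mulrA mul_polyC size_scale ?pnatr_eq0// mulrC.
    by rewrite size_mulX ?sn1// -size_poly_eq0 sn1.
  rewrite [LHS](_ : _ = size (2%:P * 'X * chebyshev n.+1 - chebyshev n))//.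
  by rewrite size_polyDl s ?size_polyN ?sn.
rewrite [LHS](_ : _ = (2%:P * 'X * chebyshev n.+1 - chebyshev n).[cosc theta])//.
rewrite hornerD hornerN !hornerM hornerC hornerX en en1 !coscMn /cosc.
have : expc ('i%C * theta) * expc (- ('i%C * theta)) = 1.
  by rewrite -expcD subrr expc0.
move: (expc _) (expc _) => F E EF; rewrite !exprS.
have -> : 2 * ((E + F) / 2) * ((E * E ^+ n + F * F ^+ n) / 2) -
  (E ^+ n + F ^+ n) / 2 =
  (E * (E * E ^+ n) + F * (F * F ^+ n) + (E * F - 1) * (E ^+ n + F ^+ n)) / 2.
  by field.
by rewrite EF subrr mul0r addr0.
Qed.

End ComplexFunctions.

Section ConjugateGradient.
Variables (R : realType) (V : vectType R[i]).
Variable form : {dot V for @Num.conj R[i]}.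
Implicit Types (A B : 'End(V)) (u v w g : V) (z : R[i]).

Definition is_hermitian A : Prop := forall u v, form (A u) v = form u (A v).

Definition is_posdef A : Prop := forall u, u != 0 -> 0 < form (A u) u.

Definition smallest_eigenvalue A (l : R) : Prop :=
  passmx.leigenvalue A l%:C /\ forall mu, passmx.leigenvalue A mu -> l%:C <= mu.

Definition largest_eigenvalue A (l : R) : Prop :=
  passmx.leigenvalue A l%:C /\ forall mu, passmx.leigenvalue A mu -> mu <= l%:C.

Definition shift_op A z : 'End(V) := z *: \1%VF + A.

Definition krylov B v (n : nat) : {vspace V} :=
  <<[seq iter k B v | k <- iota 0 n]>>%VS.

Definition is_cg_iterate B g w0 (n : nat) w : Prop :=
  let Vn := krylov B (g - B w0) n in
  w - w0 \in Vn /\ forall phi, phi \in Vn -> form (B w) phi = form g phi.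

(* Real-valued as an element of [R[i]] when [A] is Hermitian and positive. *)
Definition cg_norm A z v : R[i] :=
  sqrtC (`|z| * form v v + form (A v) v).

End ConjugateGradient.

Definition s_pt (R : realType) (z l1 lN : R[i]) : R[i] :=
  - ((l1 + lN + 2 * z) / (lN - l1)).

(* [r1] and [rN] stand for the square roots of [l1 + z] and [lN + z]. *)
Definition eta_pt (R : realType) (r1 rN : R[i]) : R[i] :=
  - ((rN - r1) / (rN + r1)).

Definition is_right_sqrt (R : realType) (z r : R[i]) : Prop :=
  r ^+ 2 = z /\ - (pi / 2) < argc r < pi / 2.

(* Main.v *)
Require Import Defs.
From mathcomp Require Import all_boot all_order all_algebra.
From mathcomp Require Import sesquilinear complex.
From mathcomp Require Import all_classical all_reals all_analysis.
From mathcomp Require Import ring lra.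

(** Write [B] for [zI + A] and [e], [e0] for the errors of the [n]th iterate and
    of the initial guess.  The Galerkin condition says that [B e] is orthogonal
    to the Krylov space [V_n], and [p(B) e0 - e0] lies in [V_n] for every
    polynomial [p] of degree at most [n] with [p(0) = 1] ([pact_sub_krylov]).
    Hence [(B e, e) = (B e, p(B) e0)].  For nonnegative [a] and [b],
    [|z a + b|] is at least [cos (arg z / 2) (|z| a + b)]
    ([half_angle_coercive]); this bounds [|(B e, e)|] below by a multiple of the
    squared energy norm of [e], while [|(B u, v)|] is at most the product of the
    energy norms ([energy_CauchySchwarz]).  So the energy norm of [e] is at most
    [sec (arg z / 2)] times that of [p(B) e0] ([energy_quasi_optimal]).

    By the spectral theorem ([eigen_decomposition]), applying [p(B)] multiplies
    the energy norm by at most the largest [|p(z + mu)|], for [mu] an eigenvalue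
    of [A] ([energy_pact_le]).  The affine map sending [z + lambda] to
    [(2 lambda - lambda1 - lambdaN) / (lambdaN - lambda1)] maps [0] to [s_z] and
    the shifted spectrum into [[-1, 1]], where [|T_n|] is at most 1; composing
    it with [T_n] and dividing by [T_n(s_z)] gives the required [p].

    Everything about [T_n] follows from the identity
    [T_n((y + 1/y) / 2) = (y^n + y^-n) / 2] ([chebyshev_joukowski]), which holds
    because every nonzero complex number is an exponential.  Taking [y = eta_z]
    gives the formula for [T_n(s_z)].  A zero of [T_n] forces [|y| = 1], hence
    is real and in [[-1, 1]]; so [T_n(s_z)] can vanish only for negative [z],
    which the condition on the argument excludes.

    For the last bound, let [a + i b] and [c + i d] be the two square roots.
    Then [c d = a b] and [c >= a > 0], whence [|d| <= |b|], and
    [1 - |eta_z|^2 = 4 (a c + b d) / |(a + c) + i (b + d)|^2] is at least a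
    constant times [1 / c], where [c] is at most a constant times the square
    root of [lambdaN] ([eta_bound]). *)

Set Implicit Arguments.
Unset Strict Implicit.
Unset Printing Implicit Defensive.

Import Order.TTheory GRing.Theory Num.Theory.

Local Open Scope ring_scope.

(** * Polynomials in an operator *)

Section PolynomialAction.
Variables (F : fieldType) (V : vectType F) (B : 'End(V)).
Implicit Types (p q : {poly F}) (u v : V) (mu : F).

(** The value at [u] of the operator [p(B)]. *)
Definition pact p u : V := \sum_(i < size p) p`_i *: iter i B u.

Lemma pact_widen n p u :
  (size p <= n)%N -> pact p u = \sum_(i < n) p`_i *: iter i B u.
Proof.
move=> le_pn; rewrite /pact (big_ord_widen n (fun i => p`_i *: iter i B u))//.
rewrite big_mkcond; apply: eq_bigr => i _; case: ltnP => // le_pi.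
by rewrite nth_default// scale0r.
Qed.

Lemma pactD p q u : pact (p + q) u = pact p u + pact q u.
Proof.
pose n := maxn (size p) (size q).
rewrite (@pact_widen n (p + q)) ?size_polyD// (@pact_widen n p) ?leq_maxl//.
rewrite (@pact_widen n q) ?leq_maxr// -big_split/=.
by apply: eq_bigr => i _; rewrite coefD scalerDl.
Qed.

Lemma pactZ a p u : pact (a *: p) u = a *: pact p u.
Proof.
rewrite (pact_widen _ (size_scale_leq a p)) /pact scaler_sumr.
by apply: eq_bigr => i _; rewrite coefZ scalerA.
Qed.

Lemma pact1 u : pact 1 u = u.
Proof. by rewrite /pact size_poly1 big_ord1 coef1 scale1r. Qed.

Lemma iter_sum (I : Type) (s : seq I) (f : I -> V) k :
  iter k B (\sum_(i <- s) f i) = \sum_(i <- s) iter k B (f i).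
Proof. by elim: k => //= k ->; rewrite linear_sum. Qed.

Lemma iter_eigen mu v k : B v = mu *: v -> iter k B v = mu ^+ k *: v.
Proof.
move=> Bv; elim: k => [|k /= ->]; first by rewrite expr0 scale1r.
by rewrite linearZ/= Bv scalerA exprSr.
Qed.

Lemma pact_sum (I : Type) (s : seq I) (f : I -> V) p :
  pact p (\sum_(i <- s) f i) = \sum_(i <- s) pact p (f i).
Proof.
rewrite /pact exchange_big/=; apply: eq_bigr => k _.
by rewrite iter_sum scaler_sumr.
Qed.

Lemma pact_eigen mu v p : B v = mu *: v -> pact p v = p.[mu] *: v.
Proof.
move=> Bv; rewrite /pact horner_coef scaler_suml.
by apply: eq_bigr => i _; rewrite (iter_eigen _ Bv) scalerA.
Qed.

Lemma pactXM p u : pact ('X * p) u = pact p (B u).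
Proof.
have sXp : (size ('X * p)%R <= (size p).+1)%N.
  by rewrite (leq_trans (size_polyMleq _ _))// size_polyX.
rewrite (pact_widen _ sXp) big_ord_recl coefXM eqxx scale0r add0r.
apply: eq_bigr => i _.
by rewrite coefXM/= -iterS iterSr.
Qed.

Lemma pact_comm p u : pact p (B u) = B (pact p u).
Proof.
by rewrite /pact linear_sum; apply: eq_bigr => i _; rewrite linearZ/= -iterSr.
Qed.

Lemma pact_prodXsubC (s : seq F) u :
  pact (\prod_(mu <- s) ('X - mu%:P)) u = foldr (fun mu v => B v - mu *: v) u s.
Proof.
elim: s => [|mu s IH]; first by rewrite big_nil pact1.
rewrite big_cons mulrBl mul_polyC pactD -scaleNr pactZ scaleNr pactXM.
by rewrite pact_comm IH.
Qed.

(** The [\dim V + 1] vectors [u, B u, ...] are linearly dependent. *)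
Lemma annihilating_poly u : exists2 p, p != 0 & pact p u = 0.
Proof.
pose n := (\dim {:V}).+1.
pose X := [tuple iter i B u | i < n].
have nfreeX : ~ free X.
  move=> /eqP dX; have := dimvS (subvf <<X>>%VS).
  by rewrite dX size_tuple ltnn.
apply: contrapT => nex; apply: nfreeX; apply/freeP => k kX i.
have [//|ki] := eqVneq (k i) 0; exfalso; apply: nex.
have coefk (j : 'I_n) : (\poly_(j < n) k (inord j))`_j = k j.
  by rewrite coef_poly ltn_ord inord_val.
exists (\poly_(j < n) k (inord j)).
  by apply: contraNneq ki => p0; rewrite -coefk p0 coef0.
rewrite (pact_widen _ (size_poly _ _)) -[RHS]kX; apply: eq_bigr => j _.
by rewrite coefk (nth_map j) ?size_enum_ord// nth_ord_enum.
Qed.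

Lemma pact_krylov n p u :
  (size p <= n)%N -> pact p u \in <<[seq iter k B u | k <- iota 0 n]>>%VS.
Proof.
move=> pn; rewrite (pact_widen _ pn); apply: memv_suml => i _; apply: memvZ.
apply: memv_span; apply/mapP; exists (i : nat) => //.
by rewrite mem_iota ltn_ord.
Qed.

(** Since [p - 1] is divisible by ['X], [p(B) u - u] is a combination of
    [B u, ..., B^n u]. *)
Lemma pact_sub_krylov n p u : (size p <= n.+1)%N -> p.[0] = 1 ->
  pact p u - u \in <<[seq iter k B (B u) | k <- iota 0 n]>>%VS.
Proof.
move=> sp p0; have /factor_theorem[q pq] : root (p - 1) 0.
  by rewrite /root hornerD hornerN hornerC p0 subrr.
move: pq; rewrite subr0 mulrC => pq.
have -> : pact p u - u = pact q (B u).
  by rewrite -pactXM -pq pactD -(scaleN1r (1 : {poly F})) pactZ pact1 scaleN1r.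
apply: pact_krylov; have [->|q0] := eqVneq q 0; first by rewrite size_poly0.
have : (size (p - 1)%R <= n.+1)%N.
  by rewrite (leq_trans (size_polyD _ _))// geq_max sp size_polyN size_poly1.
by rewrite pq mulrC size_mulX.
Qed.

End PolynomialAction.

(** Factoring an annihilating polynomial into linear factors. *)
Lemma split_annihilator (F : closedFieldType) (V : vectType F) (B : 'End(V))
  (u : V) : exists s : seq F, foldr (fun mu v => B v - mu *: v) u s = 0.
Proof.
have [p p0 pu] := annihilating_poly B u.
have [s ps] := closed_field_poly_normal p; exists s.
move: pu; rewrite ps pactZ pact_prodXsubC => /eqP.
by rewrite scaler_eq0 lead_coef_eq0 (negPf p0) => /eqP.
Qed.

(** * Hermitian operators and the energy norm *)

Section HermitianOperator.
Variables (C : numClosedFieldType) (V : vectType C).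
Variables (form : {dot V for @Num.conj C}) (A : 'End(V)).
Implicit Types (u v w : V) (mu nu : C).
Hypothesis hA : forall u v, form (A u) v = form u (A v).

Let formZl a u v : form (a *: u) v = a * form u v.
Proof. exact: linearZl_LR. Qed.
Let formZr a u v : form u (a *: v) = a^* * form u v.
Proof. exact: linearZr_LR. Qed.
Let formBl u v w : form (u - v) w = form u w - form v w.
Proof. exact: linearBl. Qed.
Let formBr u v w : form w (u - v) = form w u - form w v.
Proof. exact: linearBr. Qed.
Let opB u v : A (u - v) = A u - A v.
Proof. exact: linearB. Qed.
Let opZ a u : A (a *: u) = a *: A u.
Proof. exact: linearZ. Qed.

Lemma eigenvalue_conj mu v : A v = mu *: v -> v != 0 -> mu^* = mu.
Proof.
move=> Av v0; have := hA v v; rewrite Av formZl formZr.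
have d0 : form v v != 0 by rewrite dnorm_eq0.
by move/(mulIf d0).
Qed.

Lemma eigenvector_ortho mu nu v w :
  A v = mu *: v -> A w = nu *: w -> mu != nu -> form v w = 0.
Proof.
move=> Av Aw mn; have [->|w0] := eqVneq w 0; first by rewrite linear0r.
have := hA v w; rewrite Av Aw formZl formZr.
rewrite (eigenvalue_conj Aw w0) => /eqP; rewrite -subr_eq0 -mulrBl mulf_eq0.
by rewrite subr_eq0 (negPf mn) => /eqP.
Qed.

(** A Hermitian operator has no generalized eigenvectors of rank two. *)
Lemma no_jordan_block mu u : A (A u - mu *: u) = mu *: (A u - mu *: u) ->
  A u = mu *: u.
Proof.
set w := _ - _ => Aw; apply/eqP; rewrite -subr_eq0 -/w.
apply/negPn/negP => w0; have := w0; rewrite -(dnorm_eq0 form) => /eqP; apply.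
rewrite {1}/w formBl formZl hA Aw formZr.
by rewrite (eigenvalue_conj Aw w0) subrr.
Qed.

(** Induction on the linear factors: a decomposition of [A u - mu u] is divided
    by [nu - mu] on each eigenspace with [nu != mu], and the rest of [u] is an
    eigenvector for [mu]. *)
Lemma eigen_decomposition_of_split (s : seq C) u :
  foldr (fun mu v => A v - mu *: v) u s = 0 ->
  exists2 f : C -> V, (forall mu, A (f mu) = mu *: f mu) &
    u = \sum_(mu <- undup s) f mu.
Proof.
elim/last_ind: s u => [|s mu IH] u.
  move=> /= ->; exists (fun=> 0) => [mu|]; last by rewrite big_nil.
  by rewrite linear0 scaler0.
rewrite foldr_rcons => /IH [f Af uf].
pose g nu := (nu - mu)^-1 *: f nu.
pose x := u - \sum_(nu <- undup s | nu != mu) g nu.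
have xE : A x - mu *: x = \sum_(nu <- undup s | nu == mu) f nu.
  have -> : A x - mu *: x = (A u - mu *: u) -
      \sum_(nu <- undup s | nu != mu) (A (g nu) - mu *: g nu).
    rewrite sumrB -scaler_sumr -linear_sum /x opB scalerBr.
    by rewrite !opprB addrACA [RHS]addrACA [- _ + _]addrC.
  rewrite uf (bigID (fun nu => nu == mu))/= -addrA -sumrB [X in _ + X]big1 ?addr0// => nu nm.
  rewrite /g opZ Af !scalerA -scalerBl mulrC -mulrBl mulfV ?subr_eq0//.
  by rewrite scale1r subrr.
have Ax : A x = mu *: x.
  apply: no_jordan_block; rewrite xE linear_sum/= scaler_sumr.
  by apply: eq_bigr => nu /eqP <-; rewrite Af.
exists (fun nu => if nu == mu then x else g nu) => [nu|].
  case: eqP => [->//|_]; by rewrite /g opZ Af !scalerA mulrC.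
rewrite undup_rcons -cats1 big_cat/= big_seq1 eqxx big_filter.
rewrite (eq_bigr g) => [|nu /negPf ->//].
by rewrite /x addrC subrK.
Qed.

(** Spectral theorem: every vector is a sum of eigenvectors of [A] with distinct
    eigenvalues.  The function [f] gives the component in each eigenspace. *)
Lemma eigen_decomposition u : exists (s : seq C) (f : C -> V),
  [/\ uniq s, forall mu, A (f mu) = mu *: f mu & u = \sum_(mu <- s) f mu].
Proof.
have [s /eigen_decomposition_of_split[f Af uf]] := split_annihilator A u.
by exists (undup s), f; rewrite undup_uniq.
Qed.

Lemma form_eigen_sum (s : seq C) (f g : C -> V) : uniq s ->
  (forall mu, A (f mu) = mu *: f mu) -> (forall mu, A (g mu) = mu *: g mu) ->
  form (\sum_(mu <- s) f mu) (\sum_(mu <- s) g mu) =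
  \sum_(mu <- s) form (f mu) (g mu).
Proof.
move=> us Af Ag; rewrite linear_sumlz; apply: eq_big_seq => mu smu.
rewrite linear_sum/= (bigD1_seq mu)//= big1 ?addr0// => nu nm.
by apply: (eigenvector_ortho (Af mu) (Ag nu)); rewrite eq_sym.
Qed.

Hypothesis pA : forall u, u != 0 -> 0 < form (A u) u.

Lemma posdef_ge0 u : 0 <= form (A u) u.
Proof. by have [->|/pA/ltW//] := eqVneq u 0; rewrite linear0r. Qed.

Lemma posdef_CauchySchwarz u v :
  `|form (A u) v| ^+ 2 <= form (A u) u * form (A v) v.
Proof.
have [->|v0] := eqVneq v 0; first by rewrite linear0r normr0 expr0n/= mulr_ge0 ?posdef_ge0.
have d0 := pA v0.
have vu : form (A v) u = (form (A u) v)^*.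
  by rewrite hA (hermC form v) expr0 mul1r.
(* [u - a v] is the part of [u] orthogonal to [v] for [form (A _) _]. *)
pose a := form (A u) v / form (A v) v.
have dreal : (form (A v) v)^* = form (A v) v.
  by apply/CrealP; rewrite realE ltW.
have := posdef_ge0 (u - a *: v).
have -> : form (A (u - a *: v)) (u - a *: v) =
    form (A u) u - `|form (A u) v| ^+ 2 / form (A v) v.
  rewrite opB opZ formBl !formBr !formZl !formZr vu.
  rewrite /a rmorphM fmorphV/= dreal normCK.
  by field; rewrite gt_eqF.
by rewrite subr_ge0 ler_pdivrMr.
Qed.

(** The squared energy norm, with weight [t] standing for [|z|]. *)
Definition energy (t : C) u : C := t * form u u + form (A u) u.

Lemma energy_ge0 t u : 0 <= t -> 0 <= energy t u.
Proof. by move=> t0; rewrite addr_ge0 ?posdef_ge0// mulr_ge0 ?dnorm_ge0. Qed.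

Lemma energy_eigen_sum t (s : seq C) (f : C -> V) : uniq s ->
  (forall mu, A (f mu) = mu *: f mu) ->
  energy t (\sum_(mu <- s) f mu) = \sum_(mu <- s) energy t (f mu).
Proof.
move=> us Af; rewrite /energy big_split/= -mulr_sumr.
have -> : A (\sum_(mu <- s) f mu) = \sum_(mu <- s) A (f mu).
  exact: linear_sum.
by rewrite !form_eigen_sum// => mu; rewrite Af opZ Af.
Qed.

Lemma energyZ t a u : energy t (a *: u) = `|a| ^+ 2 * energy t u.
Proof.
by rewrite /energy opZ !formZl !formZr normCK; ring.
Qed.

Lemma energy0 t : energy t 0 = 0.
Proof. by rewrite -[X in energy t X](scale0r 0) energyZ normr0 expr0n mul0r. Qed.

Lemma energyN t u : energy t (- u) = energy t u.
Proof. by rewrite -scaleN1r energyZ normrN1 expr1n mul1r. Qed.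

(** With [B = zI + A], [p(B)] multiplies the [mu]-component by [p.[z + mu]], and
    the components are orthogonal for the energy. *)
Lemma energy_pact_le (B : 'End(V)) (z t m : C) (p : {poly C}) u :
  (forall v, B v = z *: v + A v) -> 0 <= t -> 0 <= m ->
  (forall mu v, v != 0 -> A v = mu *: v -> `|p.[z + mu]| <= m) ->
  sqrtC (energy t (pact B p u)) <= m * sqrtC (energy t u).
Proof.
move=> BE t0 m0 pm; have [s [f [us Af ->]]] := eigen_decomposition u.
have Bf mu : B (f mu) = (z + mu) *: f mu by rewrite BE Af scalerDl.
rewrite -[X in X * _](@sqrCK _ m)// -sqrtCM ?nnegrE ?exprn_ge0 ?energy_ge0//.
rewrite ler_sqrtC ?nnegrE ?mulr_ge0 ?exprn_ge0 ?energy_ge0//.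
rewrite pact_sum (eq_bigr (fun mu => p.[z + mu] *: f mu)); last first.
  by move=> mu _; apply: pact_eigen.
rewrite !energy_eigen_sum//; last first.
  by move=> mu; rewrite opZ Af !scalerA mulrC.
rewrite mulr_sumr; apply: ler_sum => mu _; rewrite energyZ.
have [->|f0] := eqVneq (f mu) 0; first by rewrite energy0 !mulr0.
by rewrite ler_wpM2r ?energy_ge0// lerXn2r ?nnegrE// (pm _ _ f0).
Qed.

(** Cauchy-Schwarz for [form] and for [form (A _) _], then in the plane. *)
Lemma energy_CauchySchwarz (z : C) u v :
  `|z * form u v + form (A u) v| <=
    sqrtC (energy `|z| u) * sqrtC (energy `|z| v).
Proof.
apply: le_trans (ler_normD _ _) _; rewrite normrM.
have [a0 b0 c0 d0] : [/\ 0 <= form u u, 0 <= form v v, 0 <= form (A u) u &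
  0 <= form (A v) v] by rewrite !dnorm_ge0 !posdef_ge0.
have [x_le _] := CauchySchwarz_sqrt form u v.
have y_le : `|form (A u) v| <= sqrtC (form (A u) u) * sqrtC (form (A v) v).
  rewrite -sqrtCM ?nnegrE// -[leLHS]sqrCK// ler_sqrtC ?nnegrE ?exprn_ge0 ?mulr_ge0//.
  exact: posdef_CauchySchwarz.
apply: le_trans (lerD (ler_wpM2l (normr_ge0 z) x_le) y_le) _.
rewrite -[leRHS]sqrtCM ?nnegrE ?energy_ge0//.
rewrite -[leLHS]sqrCK ?addr_ge0 ?mulr_ge0 ?sqrtC_ge0//.
rewrite ler_sqrtC ?nnegrE ?exprn_ge0 ?addr_ge0 ?mulr_ge0 ?sqrtC_ge0 ?energy_ge0//.
rewrite /energy -{2}[form u u]sqrtCK -{2}[form v v]sqrtCK.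
rewrite -{2}[form (A u) u]sqrtCK -{2}[form (A v) v]sqrtCK.
move: a0 b0 c0 d0; rewrite -(sqrtC_ge0 (form u u)) -(sqrtC_ge0 (form v v)).
rewrite -(sqrtC_ge0 (form (A u) u)) -(sqrtC_ge0 (form (A v) v)).
move: (sqrtC (form u u)) (sqrtC (form (A u) u)) (sqrtC (form v v)).
move: (sqrtC (form (A v) v)) (normr_ge0 z) => d t0 a b c.
move: `|z| t0 => t t0 a0 c0 b0 d0; rewrite -subr_ge0.
have -> : (t * a ^+ 2 + b ^+ 2) * (t * c ^+ 2 + d ^+ 2) -
  (t * (a * c) + b * d) ^+ 2 = t * (a * d - b * c) ^+ 2 by ring.
by rewrite mulr_ge0// real_exprn_even_ge0// rpredB// ger0_real// mulr_ge0.
Qed.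

(** Quasi-optimality (Cea's lemma): coercivity with constant [k] bounds the energy
    of [e] by [|(B e, e)| / k], which is [|(B e, y)| / k] as [B e] is orthogonal
    to [e - y]. *)
Lemma energy_quasi_optimal (z k : C) e y : 0 < k ->
  (forall a b : C, 0 <= a -> 0 <= b -> k * (`|z| * a + b) <= `|z * a + b|) ->
  z * form e (e - y) + form (A e) (e - y) = 0 ->
  sqrtC (energy `|z| e) <= k^-1 * sqrtC (energy `|z| y).
Proof.
move=> k0 coercive; rewrite !formBr mulrBr addrACA -opprD => /eqP.
rewrite subr_eq0 => /eqP Bey.
have Qe0 : 0 <= energy `|z| e by rewrite energy_ge0.
have [Qe|Qe] := eqVneq (energy `|z| e) 0.
  by rewrite Qe sqrtC0 mulr_ge0 ?invr_ge0 ?(ltW k0)// sqrtC_ge0 energy_ge0.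
rewrite mulrC ler_pdivlMr// mulrC.
have N0 : 0 < sqrtC (energy `|z| e) by rewrite sqrtC_gt0 lt_def Qe.
rewrite -(ler_pM2l N0) mulrCA -expr2 sqrtCK.
apply: le_trans (coercive _ _ (dnorm_ge0 form e) (posdef_ge0 e)) _.
by rewrite Bey energy_CauchySchwarz.
Qed.

End HermitianOperator.

Local Open Scope complex_scope.

(** * Exponentials, Tchebyshev polynomials and arguments *)

Section Scalars.
Variable R : realType.
Implicit Types (y z w s : R[i]).

Lemma expc_real (x : R) : expc x%:C = (expR x)%:C.
Proof.
rewrite /expc /= cos0 sin0.
by rewrite -[1 +i* 0]/(1%:C) -rmorphM mulr1.
Qed.

Lemma expc_imaginary (t : R) : expc ('i%C * t%:C) = cos t +i* sin t.
Proof.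
by rewrite /expc /real_complex_def /=; simpc; rewrite expR0 !mul1r.
Qed.

Lemma expc_surj y : y != 0 -> exists w, expc w = y.
Proof.
move=> y0; have [yE _] := argcP y.
have n0 : 0 < Normc.normc y.
  by rewrite -ltcR (_ : (Normc.normc y)%:C = `|y|) ?normr_gt0.
exists ((ln (Normc.normc y))%:C + 'i%C * (argc y)%:C).
by rewrite expcD expc_real lnK.
Qed.

Lemma expcN w : expc (- w) = (expc w)^-1.
Proof.
apply/esym/mulr1_eq.
by rewrite -expcD subrr expc0.
Qed.

(** The Joukowski form of Tchebyshev polynomials. *)
Lemma chebyshev_joukowski n (T : {poly R[i]}) y : is_chebyshev n T -> y != 0 ->
  T.[(y + y^-1) / 2] = (y ^+ n + y ^- n) / 2.
Proof.
case=> _ Tcos y0; have [w wE] := expc_surj y0.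
have := Tcos (- 'i%C * w); rewrite coscMn /cosc.
have -> : 'i%C * (- 'i%C * w) = w by rewrite mulrA mulrN -expr2 sqr_i opprK mul1r.
by rewrite expcN wE exprVn.
Qed.

Lemma chebyshev_norm_le1 n (T : {poly R[i]}) (x : R) :
  is_chebyshev n T -> -1 <= x <= 1 -> `|T.[x%:C]| <= 1.
Proof.
case=> _ Tcos x1.
have coscR (t : R) : cosc t%:C = (cos t)%:C.
  rewrite /cosc expc_imaginary -mulrN -rmorphN expc_imaginary cosN sinN.
  apply: (canLR (mulfK _)); first by rewrite pnatr_eq0.
  by rewrite -[2%R](rmorph_nat (real_complex R)) -rmorphM /=; simpc; congr (_ +i* _); ring.
rewrite -[x](acosK x1) -coscR Tcos.
rewrite -[n%:R](rmorph_nat (real_complex R)) -rmorphM coscR normc_def/=.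
by rewrite expr0n/= addr0 sqrtr_sqr lecR ler_norml cos_geN1 cos_le1.
Qed.

(** The witness is a root of [Y^2 - 2 s Y + 1], whose roots have product 1. *)
Lemma joukowski_surj s : exists2 y, y != 0 & s = (y + y^-1) / 2.
Proof.
have yV : (s + sqrtC (s ^+ 2 - 1)) * (s - sqrtC (s ^+ 2 - 1)) = 1.
  by rewrite mulrC -subr_sqr sqrtCK opprB addrC subrK.
exists (s + sqrtC (s ^+ 2 - 1)).
  by apply: contra_eq_neq yV => ->; rewrite mul0r eq_sym oner_eq0.
by rewrite (mulr1_eq yV); field.
Qed.

(** If [T] vanishes at [(y + y^-1) / 2] then [y ^+ n = - y ^- n], so [|y| = 1],
    [y^-1] is the conjugate of [y], and the root is the real part of [y]. *)
Lemma chebyshev_root_real n (T : {poly R[i]}) s : is_chebyshev n T ->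
  T.[s] = 0 -> exists2 x : R, s = x%:C & -1 <= x <= 1.
Proof.
have [y y0 ->] := joukowski_surj s; move=> Tn.
rewrite (chebyshev_joukowski Tn y0) => /eqP.
rewrite mulf_eq0 invr_eq0 pnatr_eq0 orbF addr_eq0 => /eqP yn.
have n0 : (0 < n)%N.
  case: n yn {Tn} => // /eqP; rewrite !expr0 invr1 -addr_eq0.
  by rewrite -[1 + 1]/(2%:R) pnatr_eq0.
have /eqP : `|y| ^+ n ^+ 2 = 1.
  by rewrite expr2 -normrX {1}yn normrN normfV mulVf// normr_eq0 expf_neq0.
rewrite -exprM pexpr_eq1 ?muln_gt0 ?n0 ?normr_ge0// => /eqP y1.
case: y y0 y1 {yn} => a b y0 y1; exists a; last first.
  move: y1; rewrite normc_def/= => -[/(congr1 (fun x => x ^+ 2))].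
  rewrite sqr_sqrtr ?addr_ge0 ?sqr_ge0// expr1n => ab.
  by rewrite -ler_norml -(@ler_pXn2r _ 2)// ?nnegrE// expr1n real_normK ?num_real//
    -ab lerDl sqr_ge0.
have -> : (a +i* b)^-1 = a -i* b.
  apply: mulr1_eq; have := normCK (a +i* b); rewrite y1 expr1n => ->.
  by [].
apply: (canLR (mulfK _)); first by rewrite pnatr_eq0.
by rewrite -[2%R](rmorph_nat (real_complex R)) -rmorphM /=; simpc; congr (_ +i* _); ring.
Qed.

Lemma argc_neg (x : R) : x < 0 -> argc x%:C = pi.
Proof.
move=> x0; rewrite /argc/= lexx expr0n/= addr0 sqrtr_sqr ltr0_norm//.
have /lt_eqF-> : x%:C < 0 by rewrite ltcE/= eqxx.
by rewrite invrN mulrN mulfV ?lt_eqF// acosN1.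
Qed.

(** With [t = argc z] and [p = |z| a], the difference of the squares of the two
    sides is [sin (t / 2) ^+ 2 * (p - b) ^+ 2]. *)
Lemma half_angle_coercive z (a b : R[i]) : 0 <= a -> 0 <= b ->
  0 <= cos (argc z / 2) ->
  (cos (argc z / 2))%:C * (`|z| * a + b) <= `|z * a + b|.
Proof.
case: a b => a a' [b b']; rewrite !(lecE 0) => /andP[/eqP/= -> a0] /andP[/eqP/= -> b0].
have [zE _] := argcP z; have nz : `|z| = (Normc.normc z)%:C by [].
rewrite nz {4}zE expc_imaginary => {zE nz}.
have : 0 <= Normc.normc z by rewrite -ler0c (_ : _%:C = `|z|) ?normr_ge0.
move: (Normc.normc z) (argc z) => r t r0 k0.
have c2 : cos t = cos (t / 2) ^+ 2 *+ 2 - 1 by rewrite -cos_mulr2n -[t / 2 *+ 2]mulr_natr divfK.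
have s2 : sin t ^+ 2 = 1 - cos t ^+ 2 by rewrite sin2cos2.
rewrite /real_complex_def; simpc => /=.
have l0 : 0 <= cos (t / 2) * (r * a + b) by rewrite mulr_ge0// addr_ge0// mulr_ge0.
rewrite -[leLHS]ger0_norm// -sqrtr_sqr ler_wsqrtr// -subr_ge0.
have -> : (r * cos t * a + b) ^+ 2 + (r * sin t * a) ^+ 2 -
    (cos (t / 2) * (r * a + b)) ^+ 2 = sin (t / 2) ^+ 2 * (r * a - b) ^+ 2.
  have -> : (r * sin t * a) ^+ 2 = (r * a) ^+ 2 * sin t ^+ 2 by ring.
  by rewrite s2 sin2cos2 c2; ring.
by rewrite mulr_ge0 ?sqr_ge0.
Qed.

Lemma right_sqrt_Re_gt0 z r : is_right_sqrt z r -> z != 0 -> 0 < complex.Re r.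
Proof.
move=> [rz rarg] z0; have r0 : r != 0.
  by apply: contraNneq z0 => r0; rewrite -rz r0 expr0n.
have [-> _] := argcP r; rewrite expc_imaginary /real_complex_def; simpc.
rewrite /= mulr_gt0 ?cos_gt0_pihalf//.
by rewrite -ltcR (_ : (Normc.normc r)%:C = `|r|) ?normr_gt0.
Qed.

Lemma right_sqrt_uniq z r r' : is_right_sqrt z r -> is_right_sqrt z r' ->
  z != 0 -> r = r'.
Proof.
move=> hr hr' z0; have re := right_sqrt_Re_gt0 hr z0.
have re' := right_sqrt_Re_gt0 hr' z0.
have /eqP : r ^+ 2 = r' ^+ 2 by rewrite (proj1 hr) (proj1 hr').
rewrite eqf_sqr => /orP[/eqP//|/eqP rE]; exfalso; move: re re'.
by rewrite rE; case: r' {rE hr hr'} => a b /=; rewrite oppr_gt0 => /lt_trans h /h; rewrite ltxx.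
Qed.

End Scalars.

(** * The convergence factor *)

Section ConvergenceFactor.
Variable R : realType.

(** As [l] grows, the square root of [l + z] in the right half-plane has
    increasing real part; its imaginary part does not grow in modulus, since the
    product of the two parts is fixed. *)
Lemma right_sqrt_monotone (a b x l1 c d lN : R) :
  0 < a -> 0 < c -> l1 < lN ->
  a ^+ 2 - b ^+ 2 = l1 + x -> c ^+ 2 - d ^+ 2 = lN + x -> c * d = a * b ->
  a <= c /\ d ^+ 2 <= b ^+ 2.
Proof.
move=> a0 c0 ll h1 hN cd.
have le_ac : a <= c.
  rewrite leNgt; apply/negP => lt_ca.
  have ca2 : c ^+ 2 < a ^+ 2 by rewrite ltr_pXn2r// ?nnegrE ltW.
  have bd2 : b ^+ 2 <= d ^+ 2.
    rewrite -(ler_pM2l (exprn_gt0 2 c0)) -[leRHS]exprMn cd exprMn.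
    by rewrite ler_wpM2r ?sqr_ge0// ltW.
  lra.
split => //; rewrite -(ler_pM2l (exprn_gt0 2 c0)) -[leLHS]exprMn cd exprMn.
by rewrite ler_wpM2r ?sqr_ge0// ler_pXn2r// ?nnegrE ltW.
Qed.

(** [a +i* b] and [c +i* d] stand for the square roots of [l1 + z] and [lN + z],
    [x] for the real part of [z]; the conclusion says that the modulus of
    [eta_pt] is at most [1 - k]. *)
Lemma sqrt_ratio_bound (a b x l1 c d lN k : R) :
  0 < a -> 0 < c -> l1 < lN -> 0 <= k ->
  a ^+ 2 - b ^+ 2 = l1 + x -> c ^+ 2 - d ^+ 2 = lN + x -> c * d = a * b ->
  k * (2 * c * (a ^+ 2 + b ^+ 2)) <= a ^+ 3 ->
  k <= 1 /\ (c - a) ^+ 2 + (d - b) ^+ 2 <=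
    (1 - k) ^+ 2 * ((c + a) ^+ 2 + (d + b) ^+ 2).
Proof.
move=> a0 c0 ll k0 h1 hN cd hk.
have [le_ac db2] := right_sqrt_monotone a0 c0 ll h1 hN cd.
have ac2 : a ^+ 2 <= c ^+ 2 by rewrite ler_pXn2r// ?nnegrE ltW.
have bd0 : 0 <= b * d.
  rewrite -(pmulr_rge0 _ (mulr_gt0 a0 c0)).
  by rewrite (_ : a * c * (b * d) = (a * b) ^+ 2) ?sqr_ge0// expr2 -{2}cd; ring.
have k1 : k * (2 * c) <= a.
  rewrite -(ler_pM2r (exprn_gt0 2 a0)) -exprS; apply: le_trans hk.
  rewrite -[leLHS]mulrA; apply: ler_wpM2l => //; apply: ler_wpM2l.
    by rewrite mulr_ge0// ltW.
  by rewrite lerDl sqr_ge0.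
split.
  have : k * (2 * c) <= 1 * (2 * c) by lra.
  by rewrite ler_pM2r// mulr_gt0.
(* With [P] for the squared modulus of the denominator, the numerator is
   [P - 4 (a c + b d)], so [k P <= 2 a c] is enough. *)
set P := (c + a) ^+ 2 + (d + b) ^+ 2.
have P0 : 0 <= P by rewrite addr_ge0 ?sqr_ge0.
have PE : a ^+ 2 * P <= 4 * c ^+ 2 * (a ^+ 2 + b ^+ 2).
  have P1 : P <= 4 * (c ^+ 2 + b ^+ 2).
    have := sqr_ge0 (c - a); have := sqr_ge0 (d - b); rewrite /P; lra.
  have : a ^+ 2 * b ^+ 2 <= c ^+ 2 * b ^+ 2 by rewrite ler_wpM2r ?sqr_ge0.
  have := ler_wpM2l (sqr_ge0 a) P1; lra.
have kP : k * P <= 2 * a * c.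
  rewrite -(ler_pM2l (exprn_gt0 2 a0)) mulrCA.
  apply: le_trans (ler_wpM2l k0 PE) _.
  have := ler_wpM2l (ltW (mulr_gt0 (ltr0n R 2) c0)) hk; lra.
have -> : (c - a) ^+ 2 + (d - b) ^+ 2 = P - 4 * (a * c) - 4 * (b * d).
  by rewrite /P; ring.
have := mulr_ge0 (sqr_ge0 k) P0; lra.
Qed.

(** The constant [c] depends on [z], [l1] and the root [r1] only. *)
Lemma eta_bound (z r1 : R[i]) (l1 : R) : 0 < l1 -> 0 < complex.Re r1 ->
  r1 ^+ 2 = l1%:C + z ->
  exists2 c : R, 0 < c & forall (lN : R) (rN : R[i]), l1 < lN ->
    0 < complex.Re rN -> rN ^+ 2 = lN%:C + z ->
    `|eta_pt r1 rN| <= (1 - c * (Num.sqrt lN)^-1)%:C.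
Proof.
case: r1 => a b; case: z => x y l10 /= a0; rewrite expr2 /real_complex_def.
simpc => -[h1 h1'].
have ab0 : 0 < a ^+ 2 + b ^+ 2 by rewrite ltr_pwDl ?exprn_gt0 ?sqr_ge0.
(* [M] is chosen so that [Re rN <= M * Num.sqrt lN], see [cM] below. *)
pose M := Num.sqrt (1 + (`|x| + b ^+ 2) / l1).
have M1 : 1 <= 1 + (`|x| + b ^+ 2) / l1.
  by rewrite lerDl divr_ge0 ?addr_ge0 ?sqr_ge0// ltW.
have M0 : 0 < M by rewrite sqrtr_gt0 (lt_le_trans ltr01).
exists (a ^+ 3 / (2 * M * (a ^+ 2 + b ^+ 2))) => [|lN rN lN1].
  by rewrite divr_gt0 ?exprn_gt0 ?mulr_gt0.
rewrite /eta_pt normrN normf_div !normc_def; case: rN => c d /= c0 hrN.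
have [hN hN'] : c * c - d * d = lN + x /\ c * d + d * c = y.
  by move: hrN; rewrite expr2; simpc => -[].
have lN0 : 0 < lN := lt_trans l10 lN1.
have s0 : 0 < Num.sqrt lN by rewrite sqrtr_gt0.
set k := _ / Num.sqrt lN.
have k0 : 0 <= k by rewrite ltW// !(divr_gt0, mulr_gt0, exprn_gt0).
have cd : c * d = a * b by lra.
have hN2 : c ^+ 2 - d ^+ 2 = lN + x by rewrite -hN !expr2.
have h12 : a ^+ 2 - b ^+ 2 = l1 + x by rewrite -h1 !expr2.
have hk : k * (2 * c * (a ^+ 2 + b ^+ 2)) <= a ^+ 3.
  have [_ db2] := right_sqrt_monotone a0 c0 lN1 h12 hN2 cd.
  have cM : c <= M * Num.sqrt lN.
    rewrite -[leLHS]ger0_norm ?(ltW c0)// -sqrtr_sqr.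
    rewrite -sqrtrM ?(le_trans ler01)// ler_wsqrtr//.
    have : (`|x| + b ^+ 2) / l1 * l1 <= (`|x| + b ^+ 2) / l1 * lN.
      by rewrite ler_wpM2l ?(ltW lN1)// divr_ge0 ?addr_ge0 ?sqr_ge0// ltW.
    rewrite divfK ?gt_eqF//; have := ler_norm x; lra.
  have -> : k * (2 * c * (a ^+ 2 + b ^+ 2)) = a ^+ 3 * (c / (M * Num.sqrt lN)).
    by rewrite /k; field; rewrite !gt_eqF.
  by rewrite ler_piMr ?exprn_ge0 ?(ltW a0)// ler_pdivrMr ?mul1r// mulr_gt0.
have [k1 kP] := sqrt_ratio_bound a0 c0 lN1 k0 h12 hN2 cd hk.
rewrite ler_pdivrMr; last first.
  by rewrite ltcR sqrtr_gt0 ltr_pwDl ?sqr_ge0// exprn_gt0// addr_gt0.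
rewrite -(rmorphM (real_complex R)) lecR -[1 - k]ger0_norm ?subr_ge0// -sqrtr_sqr.
by rewrite -sqrtrM ?sqr_ge0// ler_wsqrtr.
Qed.

End ConvergenceFactor.

(** * The error bound *)

Section Assembly.
Variable R : realType.

Lemma leigenvalueP (V : vectType R[i]) (A : 'End(V)) (mu : R[i]) :
  passmx.leigenvalue A mu <-> exists2 v, v != 0 & A v = mu *: v.
Proof.
have lkerE v : (v \in lker (A - mu *: \1%VF)) = (A v == mu *: v).
  by rewrite memv_ker add_lfunE opp_lfunE scale_lfunE id_lfunE subr_eq0.
split => [|[v v0 /eqP]].
  rewrite /passmx.leigenvalue /passmx.leigenspace -vpick0 => v0.
  by exists (vpick (lker (A - mu *: \1%VF))) => //; apply/eqP; rewrite -lkerE memv_pick.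
rewrite -lkerE => vk; apply: contraNneq v0 => k0.
by rewrite /passmx.leigenspace in k0; rewrite k0 memv0 in vk.
Qed.

Lemma posdef_eigenvalue_gt0 (V : vectType R[i])
    (form : {dot V for @Num.conj R[i]}) (A : 'End(V)) (l : R) :
  is_posdef form A -> passmx.leigenvalue A l%:C -> 0 < l.
Proof.
move=> pA /leigenvalueP[v v0 Av]; have := pA v v0.
by rewrite Av linearZl_LR pmulr_lgt0 ?dnorm_gt0// ltcR.
Qed.

Lemma s_pt_joukowski (z r1 rN l1 lN : R[i]) : l1 != lN ->
  r1 ^+ 2 = l1 + z -> rN ^+ 2 = lN + z ->
  eta_pt r1 rN != 0 /\
  s_pt z l1 lN = (eta_pt r1 rN + (eta_pt r1 rN)^-1) / 2.
Proof.
move=> ll e1 eN.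
have l1E : l1 = r1 ^+ 2 - z by rewrite e1 addrK.
have lNE : lN = rN ^+ 2 - z by rewrite eN addrK.
have : (rN - r1) * (rN + r1) != 0.
  by rewrite -subr_sqr e1 eN opprD addrACA subrr addr0 subr_eq0 eq_sym.
rewrite mulf_eq0 negb_or => /andP[d0 p0]; rewrite /eta_pt /s_pt; split.
  by rewrite oppr_eq0 mulf_neq0 ?invr_eq0.
have dl : rN ^+ 2 - z - (r1 ^+ 2 - z) != 0.
  by rewrite -lNE -l1E subr_eq0 eq_sym.
by rewrite l1E lNE; field; rewrite ?d0 ?p0 ?dl.
Qed.

(** The zeros of [T] lie in [[-1, 1]], and [s_pt z l1 lN] lies there only if [z]
    is in [[-lN, -l1]]. *)
Lemma chebyshev_s_pt_neq0 n (T : {poly R[i]}) (z : R[i]) (l1 lN : R) :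
  0 < l1 -> l1 < lN -> argc z < pi -> is_chebyshev n T ->
  T.[s_pt z l1%:C lN%:C] != 0.
Proof.
move=> l0 ll zpi Tn; apply/eqP => /(chebyshev_root_real Tn)[x sx /andP[x1 x2]].
have d0 : lN - l1 != 0 by rewrite gt_eqF// subr_gt0.
have zE : z = (- (l1 + lN + x * (lN - l1)) / 2)%:C.
  apply: (@mulfI _ 2); first by rewrite pnatr_eq0.
  rewrite -[in RHS](rmorph_nat (real_complex R)) -rmorphM.
  rewrite [in RHS]mulrC divfK ?pnatr_eq0//.
  have dC : lN%:C - l1%:C != 0 :> R[i].
    by rewrite -rmorphB (inj_eq (@complexI R) _ 0).
  have e : l1%:C + lN%:C + 2 * z = - x%:C * (lN%:C - l1%:C).
    by rewrite -sx /s_pt opprK divfK.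
  apply: (@addrI _ (l1%:C + lN%:C)); rewrite e.
  by rewrite rmorphN !(rmorphD, rmorphM, rmorphB); ring.
have xl : - (lN - l1) <= x * (lN - l1).
  by rewrite -mulN1r ler_wpM2r// subr_ge0 ltW.
rewrite zE argc_neg ?ltxx// in zpi.
rewrite pmulr_llt0 ?invr_gt0//; lra.
Qed.

Lemma cg_normN (V : vectType R[i]) (form : {dot V for @Num.conj R[i]})
  (A : 'End(V)) (z : R[i]) u : cg_norm form A z (- u) = cg_norm form A z u.
Proof. by congr sqrtC; exact: energyN. Qed.

Lemma cg_error_bound (z : R[i]) (l1 lN : R) (V : vectType R[i])
    (form : {dot V for @Num.conj R[i]}) (A : 'End(V)) (g w w0 wn : V) (n : nat)
    (T : {poly R[i]}) :
  - pi < argc z < pi -> is_hermitian form A -> is_posdef form A ->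
  smallest_eigenvalue A l1 -> largest_eigenvalue A lN -> l1 < lN ->
  shift_op A z w = g -> is_cg_iterate form (shift_op A z) g w0 n wn ->
  is_chebyshev n T ->
  cg_norm form A z (wn - w) <=
    ((cos (argc z / 2))^-1)%:C * `|T.[s_pt z l1%:C lN%:C]|^-1 *
      cg_norm form A z (w0 - w).
Proof.
move=> /andP[zpi1 zpi2] hA pA [el1 minl1] [elN maxlN] ll wg [wnV wnorth] Tn.
have l0 := posdef_eigenvalue_gt0 pA el1.
have Ts0 := chebyshev_s_pt_neq0 l0 ll zpi2 Tn.
set s := s_pt _ _ _ in Ts0 *; set B := shift_op A z in wg wnV wnorth.
have BE v : B v = z *: v + A v.
  by rewrite /B /shift_op add_lfunE scale_lfunE id_lfunE.
(* [x |-> a * x + s] maps [0] to [s] and [z + [l1, lN]] onto [[-1, 1]]. *)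
pose a : R[i] := (2 / (lN - l1))%:C.
pose p := T.[s]^-1 *: (T \Po (a *: 'X + s%:P)).
have pE x : p.[x] = T.[s]^-1 * T.[a * x + s].
  by rewrite /p hornerZ horner_comp hornerD hornerZ hornerX hornerC.
have sp : (size p <= n.+1)%N.
  have aX : (size (a *: 'X + s%:P)%R <= 2)%N.
    rewrite (leq_trans (size_polyD _ _))// geq_max.
    rewrite (leq_trans (size_scale_leq _ _)) ?size_polyX//=.
    exact: leq_trans (size_polyC_leq1 _) _.
  rewrite (leq_trans (size_scale_leq _ _))//.
  rewrite (leq_trans (size_comp_poly_leq _ _))// ltnS -[leqRHS]muln1 (proj1 Tn).
  by rewrite leq_mul2l; case: (size _) aX => [|[|[|]]]; rewrite ?orbT.
have p0 : p.[0] = 1 by rewrite pE mulr0 add0r mulVf.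
have cos0 : 0 < cos (argc z / 2).
  by rewrite cos_gt0_pihalf//; lra.
(* With the errors negated, [B (w - w0)] is the initial residual itself. *)
have -> : cg_norm form A z (wn - w) = sqrtC (energy form A `|z| (w - wn)).
  by rewrite -[RHS]/(cg_norm form A z (w - wn)) -(opprB w wn) cg_normN.
have -> : cg_norm form A z (w0 - w) = sqrtC (energy form A `|z| (w - w0)).
  by rewrite -[RHS]/(cg_norm form A z (w - w0)) -(opprB w w0) cg_normN.
rewrite -mulrA fmorphV/=.
pose y := pact B p (w - w0).
apply: le_trans (_ : _ <= (cos (argc z / 2))%:C^-1 * sqrtC (energy form A `|z| y)) _.
  apply: (energy_quasi_optimal hA pA) => [|b c b0 c0|].
  - by rewrite ltcR.
  - by apply: half_angle_coercive => //; rewrite ltW.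
  have orth phi : phi \in krylov B (g - B w0) n -> form (B (w - wn)) phi = 0.
    move=> /wnorth; rewrite linearB linearBl/= wg => ->; exact: subrr.
  have -> u : z * form (w - wn) u + form (A (w - wn)) u = form (B (w - wn)) u.
    by rewrite BE [RHS]linearDl/=; congr (_ + _); rewrite [RHS]linearZl_LR.
  apply: orth.
  have -> : w - wn - y = - (wn - w0) - (y - (w - w0)).
    by rewrite !opprB addrA [w0 - wn + _]addrC addrA subrK.
  rewrite memvB ?memvN//.
  have -> : g - B w0 = B (w - w0) by rewrite linearB/= wg.
  exact: pact_sub_krylov.
apply: ler_wpM2l; first by rewrite invr_ge0 ler0c ltW.
have := @energy_pact_le _ V form A hA pA B z `|z| `|T.[s]|^-1 p (w - w0) BE.
apply; rewrite ?invr_ge0 ?normr_ge0// => mu v v0 Av.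
have emu : passmx.leigenvalue A mu by apply/leigenvalueP; exists v.
have [m muE /andP[m1 m2]] : exists2 m, mu = m%:C & l1 <= m <= lN.
  have := maxlN _ emu; have := minl1 _ emu; case: (mu) => m m'.
  rewrite !lecE /= => /andP[/eqP-> m1] /andP[_ m2].
  by exists m; rewrite // m1 m2.
rewrite pE normrM normfV ler_piMr ?invr_ge0 ?normr_ge0//.
have d0 : 0 < lN - l1 by rewrite subr_gt0.
have -> : a * (z + mu) + s = ((2 * m - l1 - lN) / (lN - l1))%:C.
  have dC : lN%:C - l1%:C != 0 :> R[i].
    by rewrite -rmorphB (inj_eq (@complexI R) _ 0) gt_eqF.
  rewrite /a /s /s_pt muE !(fmorphV, rmorphD, rmorphM, rmorphB, rmorph_nat)/=.
  by field.
apply: (chebyshev_norm_le1 Tn).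
by rewrite ler_pdivrMr// ler_pdivlMr//; apply/andP; split; lra.
Qed.

End Assembly.

Theorem theorem3p4 (R : realType) (z : R[i]) (lambda1 : R)
    (hz : - pi < argc z < pi) :
  exists2 c : R, 0 < c &
  forall (V : vectType R[i]) (form : {dot V for @Num.conj R[i]})
    (A : 'End(V)) (lambdaN : R),
  is_hermitian form A -> is_posdef form A ->
  smallest_eigenvalue A lambda1 -> largest_eigenvalue A lambdaN ->
  lambda1 < lambdaN ->
  let s_z := s_pt z lambda1%:C lambdaN%:C in
  (forall (g w w0 wn : V) (n : nat) (T : {poly R[i]}),
     shift_op A z w = g -> is_cg_iterate form (shift_op A z) g w0 n wn ->
     is_chebyshev n T ->
     cg_norm form A z (wn - w) <=
       ((cos (argc z / 2))^-1)%:C * `|T.[s_z]|^-1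
         * cg_norm form A z (w0 - w)) /\
  (forall r1 rN : R[i],
     is_right_sqrt (lambda1%:C + z) r1 -> is_right_sqrt (lambdaN%:C + z) rN ->
     let eta_z := eta_pt r1 rN in
     (forall (n : nat) (T : {poly R[i]}), is_chebyshev n T ->
        T.[s_z] = (eta_z ^+ n + eta_z ^- n) / 2) /\
     `|eta_z| <= (1 - c * (Num.sqrt lambdaN)^-1)%:C).
Proof.
case/andP: (hz) => _ zpi.
have nz (l : R) : 0 < l -> l%:C + z != 0.
  move=> l0; apply: contraTneq zpi => /eqP; rewrite addrC addr_eq0 => /eqP->.
  by rewrite -rmorphN argc_neg ?oppr_lt0// ltxx.
(* [c] is taken from [eta_bound] when [lambda1 > 0] and the right square root
   of [lambda1 + z] exists; otherwise no constraint has to be met. *)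
pose ok (c : R) := forall (lambdaN : R) (r1 rN : R[i]), lambda1 < lambdaN ->
  is_right_sqrt (lambda1%:C + z) r1 -> is_right_sqrt (lambdaN%:C + z) rN ->
  `|eta_pt r1 rN| <= (1 - c * (Num.sqrt lambdaN)^-1)%:C.
have [c c0 okc] : exists2 c : R, 0 < c & 0 < lambda1 -> ok c.
  have [l0|l0] := ltP 0 lambda1; last by exists 1 => //; rewrite ltNge l0.
  have [[r1 r1P]|nr1] := pselect (exists r1, is_right_sqrt (lambda1%:C + z) r1).
    have [c c0 cP] := eta_bound l0 (right_sqrt_Re_gt0 r1P (nz _ l0)) (proj1 r1P).
    exists c => // _ lambdaN r rN ll /(right_sqrt_uniq r1P)/(_ (nz _ l0)) <- rNP.
    apply: cP => //; last exact: (proj1 rNP).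
    exact: right_sqrt_Re_gt0 rNP (nz _ (lt_trans l0 ll)).
  by exists 1 => // _ lambdaN r1 rN _ r1P; case: nr1; exists r1.
exists c => // V form A lambdaN hA pA h1 hN ll s_z; split.
  move=> g w w0 wn n T wg cgn Tn.
  exact: (cg_error_bound hz hA pA h1 hN ll wg cgn Tn).
have l0 := posdef_eigenvalue_gt0 pA (proj1 h1).
move=> r1 rN r1P rNP eta_z; split; last exact: okc.
have ne : lambda1%:C != lambdaN%:C by rewrite (inj_eq (@complexI R)) lt_eqF.
have [eta0 sE] := s_pt_joukowski ne (proj1 r1P) (proj1 rNP).
by move=> n T Tn; rewrite /s_z sE (chebyshev_joukowski Tn eta0).
Qed.
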